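(* Let $M$ be the Chinese monoid of rank $n\ge1$. Then $M$ satisfies the identity $xy^2x\,xy\,xy^2x = xy^2x\,yx\,xy^2x$, i.e. this equality holds in $M$ for all $x,y\in M$.
   Context: The Chinese monoid of rank $n$ is the monoid $M=\langle a_1,\dots,a_n\rangle$ defined by the relations $a_ja_ia_k=a_ja_ka_i=a_ka_ja_i$ for $i\le k\le j$. *)

(* Defs.v *)
From HB Require Import structures.
From mathcomp Require Import all_boot boolp.

Set Implicit Arguments.
Unset Strict Implicit.
Unset Printing Implicit Defensive.

Local Open Scope quotient_scope.
Local Open Scope group_scope.

Section Presentation.
Variables (A : choiceType) (R : seq A -> seq A -> Prop).

(* Least congruence containing R on the free monoid of words over A (product:
   concatenation). *)
Inductive pres_cong : seq A -> seq A -> Prop :=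
| pres_cong_rel u v : R u v -> pres_cong u v
| pres_cong_refl u : pres_cong u u
| pres_cong_sym u v : pres_cong u v -> pres_cong v u
| pres_cong_trans u v w : pres_cong u v -> pres_cong v w -> pres_cong u w
| pres_cong_cat u u' v v' :
    pres_cong u u' -> pres_cong v v' -> pres_cong (u ++ v) (u' ++ v').

Definition pres_congb : rel (seq A) := fun u v => `[< pres_cong u v >].

Fact pres_congb_refl : reflexive pres_congb.
Proof. by move=> u; apply/asboolP; apply: pres_cong_refl. Qed.

Fact pres_congb_sym : symmetric pres_congb.
Proof. by move=> u v; apply/asboolP/asboolP; apply: pres_cong_sym. Qed.

Fact pres_congb_trans : transitive pres_congb.
Proof.
by move=> v u w /asboolP uv /asboolP vw; apply/asboolP; apply: pres_cong_trans vw.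
Qed.

Canonical pres_equiv :=
  EquivRel pres_congb pres_congb_refl pres_congb_sym pres_congb_trans.

(* The monoid < A | R >. *)
Definition pres_monoid := {eq_quot pres_equiv}.
HB.instance Definition _ := Choice.on pres_monoid.
HB.instance Definition _ := Quotient.on pres_monoid.

Definition pres_word (u : seq A) : pres_monoid := \pi_pres_monoid u.

Lemma pres_wordE u v : pres_word u = pres_word v <-> pres_cong u v.
Proof.
by split=> [/eqmodP/asboolP | uv]; last by apply/eqmodP/asboolP.
Qed.

Lemma pres_word_surj (x : pres_monoid) : exists u, x = pres_word u.
Proof. by exists (repr x); rewrite /pres_word reprK. Qed.

Definition pres_mul (x y : pres_monoid) : pres_monoid :=
  pres_word (repr x ++ repr y).

Lemma pres_mul_word u v :
  pres_mul (pres_word u) (pres_word v) = pres_word (u ++ v).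
Proof.
by apply/pres_wordE; apply: pres_cong_cat; apply/pres_wordE; rewrite /pres_word reprK.
Qed.

Fact pres_mulA : associative pres_mul.
Proof.
move=> x y z; have [u ->] := pres_word_surj x; have [v ->] := pres_word_surj y.
by have [w ->] := pres_word_surj z; rewrite !pres_mul_word catA.
Qed.

Fact pres_mul1 : left_id (pres_word [::]) pres_mul.
Proof. by move=> x; have [u ->] := pres_word_surj x; rewrite pres_mul_word. Qed.

Fact pres_mulr1 : right_id (pres_word [::]) pres_mul.
Proof. by move=> x; have [u ->] := pres_word_surj x; rewrite pres_mul_word cats0. Qed.

HB.instance Definition _ :=
  isMonoid.Build pres_monoid pres_mulA pres_mul1 pres_mulr1.

Lemma pres_word_cat u v : pres_word (u ++ v) = pres_word u * pres_word v.
Proof. by rewrite -pres_mul_word. Qed.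

Lemma pres_word_nil : pres_word [::] = 1.
Proof. by []. Qed.

End Presentation.

(* The letters a_1, ..., a_n are the elements of 'I_n, hence shifted to start
   at 0; only their order matters. *)
Inductive chinese_rel (n : nat) : seq 'I_n -> seq 'I_n -> Prop :=
| chinese_jik (i k j : 'I_n) :
    i <= k <= j -> chinese_rel [:: j; i; k] [:: j; k; i]
| chinese_jki (i k j : 'I_n) :
    i <= k <= j -> chinese_rel [:: j; k; i] [:: k; j; i].

Definition chinese_monoid (n : nat) := pres_monoid (@chinese_rel n).
HB.instance Definition _ n := Monoid.on (chinese_monoid n).

(* Main.v *)
(** The rules [i <= k <= j] also define a Chinese monoid on the letters [nat],
and the rank [n] one is its image under the truncation [i |-> min i (n - 1)], so
it suffices to treat infinite rank.  There, every element is a product of rows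
R_0 R_1 ..., where R_r is a product of blocks a_r a_c (c < r) and a_r, which
pairwise commute: a letter a_c inserted on the right of R_r is either absorbed
or bumps out a letter a_d, d < r, to the left of R_r.  For s <= t, sending the
letters below s to q, those from t on to p, and the others to 1, is a
homomorphism to the bicyclic monoid <p, q | p q = 1>.  The number of cancellations
p q performed on R_0 R_1 ... is the number of blocks a_r a_c with c < s and r >= t;
hence these homomorphisms and the numbers of occurrences of the letters determine
the rows.  The identity thus follows from Adian's identity for the bicyclic
monoid. *)
From HB Require Import structures.
Require Import Defs.
From mathcomp Require Import all_boot zify.

Set Implicit Arguments.
Unset Strict Implicit.
Unset Printing Implicit Defensive.

Local Open Scope group_scope.

(** * Transport of congruences and products of commuting factors *)

Lemma pres_cong_map (A B : choiceType) (R : seq A -> seq A -> Prop)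
    (S : seq B -> seq B -> Prop) (f : A -> B) :
  (forall u v, R u v -> S (map f u) (map f v)) ->
  forall u v, pres_cong R u v -> pres_cong S (map f u) (map f v).
Proof.
move=> RS u v; elim=> {u v} [u v /RS|u|u v _|u v w _ uv _|u u' v v' _ uu' _ vv'].
- exact: pres_cong_rel.
- exact: pres_cong_refl.
- exact: pres_cong_sym.
- exact: pres_cong_trans.
- by rewrite !map_cat; apply: pres_cong_cat.
Qed.

Lemma perm_prodg_commute (M : monoidType) (I : eqType) (F : I -> M) (r s : seq I) :
    (forall i j, commute (F i) (F j)) -> perm_eq r s ->
  \prod_(i <- r) F i = \prod_(i <- s) F i.
Proof.
move=> FC; elim: r s => [|i r IHr] s rs; first by move: rs; rewrite perm_sym => /perm_nilP ->.
have /splitPr def_s : i \in s by rewrite -(perm_mem rs) mem_head.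
case: def_s rs => s1 s2; rewrite -[i :: s2]cat1s perm_sym perm_catCA perm_cons perm_sym => rs.
rewrite big_cons (IHr _ rs) !big_cat big_seq1 /= !mulgA; congr (_ * _).
by apply: commute_prod => j _; apply: FC.
Qed.

(** * The bicyclic monoid and Adian's identity *)

Definition bicyclic := (nat * nat)%type.

(* The pair [(a, b)] stands for [q ^ a * p ^ b], where [p * q = 1]. *)
Definition bmul (x y : bicyclic) : bicyclic :=
  (x.1 + (y.1 - x.2), y.2 + (x.2 - y.1))%N.

Fact bmulA : associative bmul.
Proof. by case=> [a b] [c d] [e f]; rewrite /bmul /=; congr pair; lia. Qed.

Fact bmul0x : left_id (0, 0)%N bmul.
Proof. by case=> a b; rewrite /bmul /=; congr pair; lia. Qed.

Fact bmulx0 : right_id (0, 0)%N bmul.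
Proof. by case=> a b; rewrite /bmul /=; congr pair; lia. Qed.

HB.instance Definition _ :=
  Monoid.isLaw.Build bicyclic (0, 0)%N bmul bmulA bmul0x bmulx0.

(* The middle factors have the same degree a - b, and by hypothesis are absorbed
by the same one of the two outer factors, where only this degree matters. *)
Lemma bmul_sandwich (x e f : bicyclic) :
    (e.1 + f.2 = f.1 + e.2)%N ->
    (e.1 <= x.2)%N && (f.1 <= x.2)%N || (e.2 <= x.1)%N && (f.2 <= x.1)%N ->
  bmul (bmul x e) x = bmul (bmul x f) x.
Proof.
case: x e f => [a b] [c d] [e f]; rewrite /bmul /= => ? ?.
by congr pair; lia.
Qed.

Lemma adian_bicyclic (x y a : bicyclic) : a = bmul (bmul x (bmul y y)) x ->
  bmul (bmul a (bmul x y)) a = bmul (bmul a (bmul y x)) a.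
Proof.
move=> ->; apply: bmul_sandwich; case: x y => [a1 a2] [b1 b2];
  by rewrite /bmul /=; lia.
Qed.

(** * Infinite rank: invariants of the congruence *)

Inductive chinese_nat_rel : seq nat -> seq nat -> Prop :=
| chinese_nat_jik (i k j : nat) :
    (i <= k <= j)%N -> chinese_nat_rel [:: j; i; k] [:: j; k; i]
| chinese_nat_jki (i k j : nat) :
    (i <= k <= j)%N -> chinese_nat_rel [:: j; k; i] [:: k; j; i].

Local Notation ev := (pres_word chinese_nat_rel).

(** Booleans serve as exponents: for [s <= t] at most one of them is 1, so the image is q, p or the
    identity. *)
Definition bletter (s t i : nat) : bicyclic := ((i < s)%N : nat, (t <= i)%N : nat).

Definition bword (s t : nat) (u : seq nat) : bicyclic :=
  \big[bmul/(0, 0)%N]_(i <- u) bletter s t i.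

Lemma bword_cat (s t : nat) (u v : seq nat) :
  bword s t (u ++ v) = bmul (bword s t u) (bword s t v).
Proof. exact: big_cat. Qed.

Lemma bword_cong (s t : nat) (u v : seq nat) : (s <= t)%N ->
  pres_cong chinese_nat_rel u v -> bword s t u = bword s t v.
Proof.
move=> st; elim=> {u v} [u v|//|//|u v w _ -> _ -> //|u u' v v' _ uu' _ vv'].
  suff E i k j : (i <= k <= j)%N ->
      bword s t [:: j; i; k] = bword s t [:: j; k; i] /\
      bword s t [:: j; k; i] = bword s t [:: k; j; i].
    by case=> i k j /E[].
  case/andP=> ik kj; rewrite /bword !big_cons big_nil /bletter.
  (* Only these implications matter: they leave finitely many truth assignments, and each is settled
     by computation. *)
  have : [&& (k < s) ==> (i < s), (j < s) ==> (k < s), (t <= i) ==> (t <= k),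
             (t <= k) ==> (t <= j) & ~~ ((k < s) && (t <= k))]%N by lia.
  by do 3 case: (_ < s)%N; do 3 case: (t <= _)%N.
by rewrite !bword_cat uu' vv'.
Qed.

Lemma perm_cong (u v : seq nat) : pres_cong chinese_nat_rel u v -> perm_eq u v.
Proof.
elim=> {u v} [u v|//|u v _|u v w _ uv _ /(perm_trans uv) //|u u' v v' _ uu' _ vv'].
- by case=> i k j _; apply/permP => P /=; lia.
- by rewrite perm_sym.
- exact: perm_cat.
Qed.

(** * Rows and reduction of words to products of rows *)

(** The entry [c = r] encodes the one-letter block a_r, so a row is given by one list of entries,
    all at most [r]. *)
Definition block (r c : nat) : seq nat := if (c < r)%N then [:: r; c] else [:: r].

Definition row (r : nat) (s : seq nat) : seq nat := flatten (map (block r) s).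

Arguments row : simpl never.

Lemma row_cons (r c : nat) (s : seq nat) : row r (c :: s) = block r c ++ row r s.
Proof. by []. Qed.

Definition rows (m : nat) (T : nat -> seq nat) : seq nat :=
  flatten [seq row r (T r) | r <- iota 0 m].

Lemma rowsS (m : nat) (T : nat -> seq nat) :
  rows m.+1 T = rows m T ++ row m (T m).
Proof. by rewrite /rows -addn1 iotaD map_cat flatten_cat /= cats0. Qed.

Lemma eq_rows (m : nat) (T T' : nat -> seq nat) :
  (forall r, (r < m)%N -> T r = T' r) -> rows m T = rows m T'.
Proof.
move=> TT'; congr flatten; apply/eq_in_map => r.
by rewrite mem_iota => /TT' ->.
Qed.

Lemma chinese_jik_jki (i k j : nat) : (i <= k <= j)%N ->
  ev [:: j; i; k] = ev [:: j; k; i].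
Proof. by move=> ikj; apply/pres_wordE/pres_cong_rel; constructor. Qed.

(** For [c < r] the two relations chain: a_r a_c a_k = a_r a_k a_c = a_k a_r a_c. *)
Lemma block_letterC (r c k : nat) : (c <= k <= r)%N ->
  commute (ev (block r c)) (ev [:: k]).
Proof.
move=> ckr; rewrite /commute -!pres_word_cat /block.
case: ltnP => cr /=; last by have ->: k = r by lia.
apply/pres_wordE; apply: (@pres_cong_trans _ _ _ [:: r; k; c]);
  by apply: pres_cong_rel; constructor.
Qed.

Lemma ev_cons (i : nat) (u : seq nat) : ev (i :: u) = ev [:: i] * ev u.
Proof. by rewrite -pres_word_cat. Qed.

Lemma ev_block (r c : nat) :
  ev (block r c) = if (c < r)%N then ev [:: r] * ev [:: c] else ev [:: r].
Proof. by rewrite /block; case: ltnP; rewrite // ev_cons. Qed.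

(** For [c <= d], the block of [c] commutes with each letter of the block of [d]. *)
Lemma blockC (r c d : nat) : commute (ev (block r c)) (ev (block r d)).
Proof.
wlog cd : c d / (c <= d)%N => [IH|].
  by case: (leqP c d) => [|/ltnW] /IH // /commute_sym.
case: (leqP r c) => [rc|cr].
  by rewrite !ev_block !ifN -?leqNgt // (leq_trans rc).
have cr' : commute (ev (block r c)) (ev [:: r]).
  by apply: block_letterC; rewrite leqnn ltnW.
rewrite [ev (block r d)]ev_block; case: ltnP => dr //.
by apply: commuteM => //; apply: block_letterC; rewrite cd ltnW.
Qed.

Lemma ev_flatten (ss : seq (seq nat)) : ev (flatten ss) = \prod_(u <- ss) ev u.
Proof.
elim: ss => [|u ss IH] /=; first by rewrite big_nil pres_word_nil.
by rewrite pres_word_cat big_cons IH.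
Qed.

Lemma ev_row (r : nat) (s : seq nat) :
  ev (row r s) = \prod_(c <- s) ev (block r c).
Proof. by rewrite ev_flatten big_map. Qed.

Lemma perm_ev_row (r : nat) (s s' : seq nat) :
  perm_eq s s' -> ev (row r s) = ev (row r s').
Proof. by rewrite !ev_row; apply: perm_prodg_commute => i j; apply: blockC. Qed.

Lemma row_letterC (r k : nat) (s : seq nat) :
  all (fun c => c <= k)%N s -> (k <= r)%N ->
  commute (ev [:: k]) (ev (row r s)).
Proof.
move=> /allP sk kr; rewrite ev_row big_seq; apply: commute_prod => c /sk ck.
by apply/commute_sym/block_letterC; rewrite ck.
Qed.

Lemma row_rcons (r c : nat) (s : seq nat) :
  ev (row r (c :: s)) = ev (row r s) * ev (block r c).
Proof.
rewrite (@perm_ev_row _ _ (s ++ [:: c])); last first.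
  by rewrite cats1 perm_sym perm_rcons.
by rewrite !ev_row big_cat big_seq1.
Qed.

Lemma row_insert (r c : nat) (s : seq nat) :
    all (fun d => d <= r)%N s -> (c < r)%N ->
  (exists2 s', all (fun d => d <= r)%N s' & ev (row r s) * ev [:: c] = ev (row r s'))
  \/ (exists d s', [/\ (d < r)%N, all (fun d => d <= r)%N s' &
        ev (row r s) * ev [:: c] = ev [:: d] * ev (row r s')]).
Proof.
have rems P d : all P s -> all P (rem d s).
  by move=> /allP sP; apply/allP => e /mem_rem /sP.
move=> sr cr; have [rs|rNs] := boolP (r \in s).
  (* A one-letter block a_r absorbs a_c and becomes a_r a_c. *)
  left; exists (c :: rem r s); first by rewrite /= ltnW ?rems.
  rewrite (perm_ev_row r (perm_to_rem rs)) !row_rcons !ev_block ltnn cr -!mulgA //.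
have {}sr : all (fun d => d < r)%N s.
  apply/allP => d ds; rewrite ltn_neqAle (allP sr) // andbT.
  by apply: contraNneq rNs => <-.
have srW s' : all (fun d => d < r)%N s' -> all (fun d => d <= r)%N s'.
  by apply: sub_all => d /ltnW.
right; have [sc|/allPn[d0 d0s]] := boolP (all (fun d => d <= c)%N s).
  (* All entries are at most [c], so a_c itself passes through the whole row. *)
  exists c, s; split=> //; first exact: srW.
  by apply/esym/row_letterC => //; apply: ltnW.
rewrite -ltnNge => cd0.
have [d ds dmax] : exists2 d, d \in s & all (fun e => e <= d)%N s.
  have /= ex : exists d, d \in s by exists d0.
  have bnd d : d \in s -> (d <= r)%N by move/(allP sr)/ltnW.
  by case: (ex_maxnP ex bnd) => d ds dm; exists d => //; apply/allP.
have cd : (c < d)%N by apply: leq_trans cd0 (allP dmax _ _).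
have dr := allP sr _ ds.
(* The largest entry [d] is bumped: a_r a_d a_c = a_r a_c a_d, and a_d then passes through the new
   row, whose entries are all at most [d]. *)
exists d, (c :: rem d s); split=> //; first by rewrite /= ltnW ?srW ?rems.
rewrite (_ : _ * _ = ev (row r (c :: rem d s)) * ev [:: d]).
  by apply/esym/row_letterC; rewrite /= ?(ltnW cd) ?rems // ltnW.
rewrite (perm_ev_row r (perm_to_rem ds)) !row_rcons -!mulgA; congr (_ * _).
rewrite /block dr cr -!pres_word_cat /=.
by apply/esym/chinese_jik_jki; rewrite (ltnW cd) (ltnW dr).
Qed.

Lemma ev_rowsS (m : nat) (T : nat -> seq nat) :
  ev (rows m.+1 T) = ev (rows m T) * ev (row m (T m)).
Proof. by rewrite rowsS pres_word_cat. Qed.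

Definition row_bounded (T : nat -> seq nat) :=
  forall r, all (fun c => c <= r)%N (T r).

(** Insertion starts in the last row; a bumped letter has a smaller index than that row and goes by
    induction into the preceding ones. *)
Lemma rows_insert (m c : nat) (T : nat -> seq nat) :
    row_bounded T -> (c < m)%N ->
  exists2 T', row_bounded T' & ev (rows m T) * ev [:: c] = ev (rows m T').
Proof.
elim: m c T => // m IHm c T Tb; rewrite ltnS leq_eqVlt => cm.
pose upd (T : nat -> seq nat) s r := if (r == m)%N then s else T r.
have updb T0 s : row_bounded T0 -> all (fun c => c <= m)%N s -> row_bounded (upd T0 s).
  by move=> T0b sb r; rewrite /upd; case: eqP => [->|].
have updE T0 s : ev (rows m.+1 (upd T0 s)) = ev (rows m T0) * ev (row m s).
  rewrite ev_rowsS /upd eqxx; congr (ev _ * _); apply: eq_rows => r rm.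
  by rewrite ltn_eqF.
case: eqP cm => /= [-> _|_ cm].
  exists (upd T (m :: T m)); first by apply: updb; rewrite //= leqnn Tb.
  by rewrite updE ev_rowsS row_rcons mulgA ev_block ltnn.
case: (row_insert (Tb m) cm) => [[s sb Es]|[d [s [dm sb Es]]]].
  by exists (upd T s); [apply: updb | rewrite updE ev_rowsS -mulgA Es].
case: (IHm d T Tb dm) => T' T'b ET'; exists (upd T' s); first exact: updb.
by rewrite updE ev_rowsS -mulgA Es mulgA ET'.
Qed.

Lemma rows_exist (m : nat) (u : seq nat) : all (fun c => c < m)%N u ->
  exists2 T, row_bounded T & ev u = ev (rows m T).
Proof.
elim/last_ind: u => [_|u c IHu].
  exists (fun=> [::]) => //; congr ev.
  by elim: m => // m IHm; rewrite rowsS -IHm.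
rewrite all_rcons => /andP[cm /IHu[T Tb ET]].
by case: (rows_insert Tb cm) => T' T'b E; exists T'; rewrite // -cats1 pres_word_cat ET.
Qed.

(** * Bicyclic images of rows *)

Lemma bword_block_lt (s t r c : nat) : (s <= t)%N -> (r < t)%N ->
  (bword s t (block r c)).2 = 0%N.
Proof.
move=> st rt; rewrite /block; case: ltnP => cr;
  by rewrite /bword !big_cons big_nil /bletter /bmul /=; lia.
Qed.

(** Here a_r goes to p, which is cancelled exactly when a_c goes to q; [count (leq t)] is the number
    of letters sent to p. *)
Lemma bword_block_ge (s t r c : nat) : (s <= t)%N -> (t <= r)%N -> (c <= r)%N ->
  (bword s t (block r c)).1 = 0%N /\
  ((bword s t (block r c)).2 + (c < s))%N = count (leq t) (block r c).
Proof.
move=> st tr cr; rewrite /block; case: ltnP => ?;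
  by rewrite /bword !big_cons big_nil /bletter /bmul /=; lia.
Qed.

Lemma bword_row_lt (s t r : nat) (l : seq nat) : (s <= t)%N -> (r < t)%N ->
  all (fun c => c <= r)%N l ->
  (bword s t (row r l)).2 = 0%N /\ count (leq t) (row r l) = 0%N.
Proof.
move=> st rt; elim: l => [|c l IHl] /=; first by rewrite /bword big_nil.
case/andP=> cr /IHl[E1 E2]; rewrite row_cons bword_cat count_cat E2 /bmul /= E1.
rewrite bword_block_lt //; split=> //.
by rewrite /block; case: ltnP => ? /=; lia.
Qed.

Lemma bword_row_ge (s t r : nat) (l : seq nat) : (s <= t)%N -> (t <= r)%N ->
  all (fun c => c <= r)%N l ->
  (bword s t (row r l)).1 = 0%N /\
  ((bword s t (row r l)).2 + count (fun c => c < s)%N l)%N = count (leq t) (row r l).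
Proof.
move=> st tr; elim: l => [|c l IHl] /=; first by rewrite /bword big_nil.
case/andP=> cr /IHl[E1 E2]; rewrite row_cons bword_cat count_cat -E2 /bmul /= E1.
by have [B1 <-] := bword_block_ge st tr cr; rewrite B1; lia.
Qed.

Lemma count_rows_lt (t m : nat) (T : nat -> seq nat) :
  (m <= t)%N -> row_bounded T -> count (leq t) (rows m T) = 0%N.
Proof.
move=> mt Tb; elim: m mt => // m IHm mt.
by rewrite rowsS count_cat (bword_row_lt (leq0n t) mt (Tb m)).2 IHm // ltnW.
Qed.

(** Rows below [t] give powers of q and stand to the left of the others, which give powers of p.
    Hence p q cancels only inside blocks, and the sum counts these cancellations. *)
Lemma bword_rows (s t m : nat) (T : nat -> seq nat) :
    (s <= t)%N -> row_bounded T ->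
  ((bword s t (rows m T)).2 + \sum_(t <= r < m) count (fun c => c < s)%N (T r))%N
    = count (leq t) (rows m T).
Proof.
move=> st Tb; elim: m => [|m IHm].
  by rewrite big_geq // /bword big_nil.
rewrite rowsS bword_cat count_cat -IHm /bmul /=.
case: (ltnP m t) => mt.
  have [-> ->] := bword_row_lt st mt (Tb m).
  by move: IHm; rewrite (count_rows_lt (ltnW mt) Tb) !big_geq ?(ltnW mt) //; lia.
have [-> <-] := bword_row_ge st mt (Tb m).
by rewrite big_nat_recr //=; lia.
Qed.

(** * Recovering the rows from the invariants *)

Lemma count_mem_row (i r : nat) (l : seq nat) : all (fun c => c <= r)%N l ->
  count_mem i (row r l) = if r == i then size l else count_mem i l.
Proof.
elim: l => [|c l IHl] /=; first by case: ifP.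
case/andP=> cr /IHl; rewrite row_cons count_cat => ->.
by rewrite /block; case: ltnP => rc /=; case: (eqVneq r i) => ? /=; lia.
Qed.

Lemma count_mem_rows (i m : nat) (T : nat -> seq nat) : row_bounded T ->
  count_mem i (rows m T)
    = (\sum_(0 <= r < m) if r == i then size (T r) else count_mem i (T r))%N.
Proof.
move=> Tb; elim: m => [|m IHm]; first by rewrite big_geq.
by rewrite rowsS count_cat IHm count_mem_row // big_nat_recr.
Qed.

(** Differences of cancellation numbers, first in [t] and then in [s], give the multiplicities of
    the entries [c < r]. Row [r] has one a_r per block, so the occurrences of a_r give its size, and
    the entries equal to [r] make up the remainder. *)
Lemma rows_inj (m : nat) (T T' : nat -> seq nat) :
    row_bounded T -> row_bounded T' -> perm_eq (rows m T) (rows m T') ->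
    (forall s t, (s <= t)%N -> bword s t (rows m T) = bword s t (rows m T')) ->
  forall r, (r < m)%N -> perm_eq (T r) (T' r).
Proof.
move=> Tb T'b TT' bTT' r rm.
have sumE s t : (s <= t)%N ->
    \sum_(t <= i < m) count (fun c => c < s)%N (T i)
    = \sum_(t <= i < m) count (fun c => c < s)%N (T' i).
  move=> st; apply/eqP; rewrite -(eqn_add2l (bword s t (rows m T)).2).
  by rewrite bword_rows // bTT' // bword_rows // (permP TT').
have ltE s k : (s <= k < m)%N ->
    count (fun c => c < s)%N (T k) = count (fun c => c < s)%N (T' k).
  case/andP=> sk km; have := sumE s k sk.
  rewrite !(big_ltn km) (sumE s k.+1 (leqW sk)) => /eqP.
  by rewrite eqn_add2r => /eqP.
have countE (s : seq nat) c :
    (count_mem c s + count (fun e => e < c) s = count (fun e => e < c.+1) s)%N.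
  by elim: s => //= e s <-; lia.
have lt_eq c k : (c < k < m)%N -> count_mem c (T k) = count_mem c (T' k).
  move=> /andP[ck km]; apply/eqP.
  rewrite -(eqn_add2r (count (fun e => e < c) (T k))%N) countE ltE ?ck //.
  by rewrite [X in (_ + X)%N]ltE ?countE // (ltnW ck).
have gt_eq0 U c k : row_bounded U -> (k < c)%N -> count_mem c (U k) = 0%N.
  move=> Ub kc; apply/eqP; rewrite -leqn0 leqNgt -has_count has_pred1.
  by apply/negP => /(allP (Ub k)); rewrite leqNgt kc.
(* Occurrences of a_r outside row [r] are entries of later rows, already known to agree by
   [lt_eq]. *)
have size_eq : size (T r) = size (T' r).
  apply/eqP; move: (permP TT' (pred1 r)); rewrite !count_mem_rows //.
  have r_iota : r \in index_iota 0 m by rewrite mem_index_iota.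
  rewrite !(bigD1_seq r) ?iota_uniq //= eqxx => /eqP.
  rewrite [X in (_ + X)%N == _](_ : _ =
    \sum_(0 <= i < m | i != r) if i == r then size (T' i) else count_mem r (T' i))%N.
    by rewrite eqn_add2r.
  rewrite big_seq_cond [RHS]big_seq_cond; apply: eq_bigr => k.
  rewrite mem_index_iota => /andP[/= km kr]; rewrite (negPf kr).
  case: (ltngtP k r) kr => // [kr|rk] _; first by rewrite !gt_eq0.
  by apply: lt_eq; rewrite rk.
have countW U : row_bounded U ->
    (count_mem r (U r) + count (fun e => e < r) (U r) = size (U r))%N.
  move=> Ub; rewrite countE -(count_predT (U r)).
  by apply: eq_in_count => e /(allP (Ub r)).
apply/allP => c _; apply/eqP => /=.
case: (ltngtP c r) => [cr|rc|->]; first by rewrite lt_eq ?cr.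
  by rewrite !gt_eq0.
apply/eqP; rewrite -(eqn_add2r (count (fun e => e < r) (T r))%N) countW //.
by rewrite ltE ?countW ?size_eq // leqnn.
Qed.

(** Both words reduce to products of rows with the same invariants, hence with the same entries up
    to order. *)
Lemma chinese_nat_separation (u v : seq nat) :
    perm_eq u v -> (forall s t, (s <= t)%N -> bword s t u = bword s t v) ->
  ev u = ev v.
Proof.
move=> uv buv; pose m := (\max_(c <- u) c).+1.
have um : all (fun c => c < m)%N u.
  by apply/allP => c cu; rewrite ltnS; apply: leq_bigmax_seq.
have vm : all (fun c => c < m)%N v by rewrite -(perm_all _ uv).
have [[T Tb uT] [T' T'b vT']] := (rows_exist um, rows_exist vm).
rewrite uT vT' !ev_flatten !big_map; apply: eq_big_seq => r.
rewrite mem_iota => /rows_inj rm; apply: perm_ev_row; apply: rm => // [|s t st].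
  rewrite -(permPl (perm_cong (iffLR (pres_wordE _ _ _) uT))).
  by rewrite -(permPr (perm_cong (iffLR (pres_wordE _ _ _) vT'))).
rewrite -(bword_cong st (iffLR (pres_wordE _ _ _) uT)).
by rewrite -(bword_cong st (iffLR (pres_wordE _ _ _) vT')) buv.
Qed.

(** * The identity, in infinite and then in finite rank *)

Lemma chinese_nat_adian (u v a : seq nat) : a = u ++ (v ++ v) ++ u ->
  pres_cong chinese_nat_rel (a ++ (u ++ v) ++ a) (a ++ (v ++ u) ++ a).
Proof.
move=> def_a; apply/pres_wordE/chinese_nat_separation => [|s t st].
  by rewrite perm_cat2l perm_cat2r perm_catC.
rewrite ![bword _ _ (a ++ _)]bword_cat ![bword _ _ (_ ++ a)]bword_cat !bmulA.
by rewrite ![bword _ _ (_ ++ _)]bword_cat; apply: adian_bicyclic; rewrite def_a !bword_cat bmulA.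
Qed.

Theorem corollary3p3p4 (n : nat) (hn : (1 <= n)%N) (x y : chinese_monoid n) :
  x * y ^+ 2 * x * x * y * x * y ^+ 2 * x
    = x * y ^+ 2 * x * y * x * x * y ^+ 2 * x.
Proof.
case: n hn x y => // n _ x y.
(* The rank is now [n.+1], with top letter [n]. Truncation is monotone, so it preserves the
   relations, and it is a left inverse of the inclusion of letters. *)
pose trunc i : 'I_n.+1 := inord (minn i n).
have truncE i : nat_of_ord (trunc i) = minn i n by rewrite inordK // ltnS geq_minr.
have truncK : cancel (@nat_of_ord n.+1) trunc.
  by move=> i; apply: val_inj; rewrite /= truncE (minn_idPl _) // -ltnS.
have trunc_rel u v : chinese_nat_rel u v ->
    @chinese_rel n.+1 (map trunc u) (map trunc v).
  by case=> i k j ikj; constructor; rewrite !truncE; lia.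
have [u ->] := pres_word_surj x; have [v ->] := pres_word_surj y.
have := pres_cong_map trunc_rel (@chinese_nat_adian (map val u) (map val v) _ erefl).
rewrite !map_cat !(mapK truncK) => /pres_wordE.
by rewrite !pres_word_cat !expgS !expg0 !mulg1 !mulgA.
Qed.
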